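(* Let $n\ge 1$ and let $r_1,\ldots,r_n$ be positive integers, and put $N=r_1r_2\cdots r_n$. Every ideal of the ring $\mathbb{Z}[x_1,\ldots,x_n]/\langle x_1^{r_1}-1,\,x_2^{r_2}-1,\ldots,x_n^{r_n}-1\rangle$, regarded as a subset of $\mathbb{Z}^{N}=\mathbb{Z}^{r_1\times\cdots\times r_n}$ via the coefficient tensor identification, is a multivariate cyclic lattice.
   Context: Let $\mathfrak{a}=\langle x_1^{r_1}-1,\ldots,x_n^{r_n}-1\rangle\subseteq\mathbb{Z}[x_1,\ldots,x_n]$. The ring $\mathbb{Z}[x_1,\ldots,x_n]/\mathfrak{a}$ is a free $\mathbb{Z}$-module with basis the classes of $x_1^{\alpha_1}\cdots x_n^{\alpha_n}$, $0\le\alpha_k\le r_k-1$. An element $\sum_\alpha a_{\alpha}x^\alpha+\mathfrak{a}$ (written in this basis) is identified with its coefficient tensor $\mathcal{A}=(a_{(\alpha_1,\ldots,\alpha_n)})\in\mathbb{Z}^{r_1\times\cdots\times r_n}\cong\mathbb{Z}^N$. For a tensor $\mathcal{A}\in\mathbb{Z}^{r_1\times\cdots\times r_n}$ (indices starting from $0$), $i\in\{1,\ldots,n\}$ and $0\le j\le r_i-1$, let $A_i(j)$ be the order-$(n-1)$ tensor obtained from $\mathcal{A}$ by fixing the $i$-th index equal to $j$, and let $\mathcal{A}_i=(A_i(0),A_i(1),\ldots,A_i(r_i-1))$. The $i$-th multivariate cyclic shift $\sigma_i(\mathcal{A})$ is the tensor obtained by cyclically shifting by one position the entries of the ordered tuple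 $\mathcal{A}_i$, i.e. $(A_i(0),\ldots,A_i(r_i-1))\mapsto(A_i(r_i-1),A_i(0),\ldots,A_i(r_i-2))$. An (integer) lattice in $\mathbb{Z}^N$ is an additive subgroup of $\mathbb{Z}^N$. A lattice $\mathcal{L}\subseteq\mathbb{Z}^N=\mathbb{Z}^{r_1\times\cdots\times r_n}$ is a multivariate cyclic lattice if for all $v\in\mathcal{L}$ and all $i=1,\ldots,n$, the $i$-th multivariate cyclic shift $\sigma_i(v)$ also belongs to $\mathcal{L}$. *)

(* Defs.v *)
From HB Require Import structures.
From mathcomp Require Import all_boot all_order all_algebra.
From mathcomp Require Import boolp classical_sets.
From mathcomp Require Import ring_quotient ssrcomplements mpoly.

Set Implicit Arguments.
Unset Strict Implicit.
Unset Printing Implicit Defensive.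

Import GRing.Theory.
Local Open Scope classical_set_scope.
Local Open Scope ring_scope.
Local Open Scope quotient_scope.

(* MathComp's [idealr_closed] only covers proper ideals, so the ideals of a
   commutative ring (the unit ideal included) are defined here. *)
Definition is_ideal (R : comNzRingType) (I : set R) : Prop :=
  [/\ I 0, (forall a b, I a -> I b -> I (a + b))
    & (forall c a, I a -> I (c * a))].

Definition is_lattice (V : zmodType) (L : set V) : Prop :=
  [/\ L 0, (forall u v, L u -> L v -> L (u + v))
    & (forall u, L u -> L (- u))].

Section CyclicQuotient.
Variables (n : nat) (r : 'I_n -> nat).

Definition cyclic_gen (i : 'I_n) : {mpoly int[n]} := 'X_i ^+ r i - 1.

Definition cyclic_relations (p : {mpoly int[n]}) : bool :=
  `[< exists q : 'I_n -> {mpoly int[n]}, p = \sum_i q i * cyclic_gen i >].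

Lemma cyclic_relations_idealr : idealr_closed cyclic_relations.
Proof.
split.
- apply/asboolP; exists (fun=> 0); rewrite big1 // => i _; exact: mul0r.
- apply/asboolP => -[q /(congr1 (meval (fun=> 1)))].
  rewrite rmorph1 rmorph_sum big1 => [/eqP|i _] /=; first by rewrite oner_eq0.
  by rewrite rmorphM /cyclic_gen rmorphB rmorphXn /= mevalXU rmorph1 expr1n subrr mulr0.
- move=> c p1 p2 /asboolP[q1 ->] /asboolP[q2 ->]; apply/asboolP.
  exists (fun i => c * q1 i + q2 i); rewrite mulr_sumr -big_split /=.
  by apply: eq_bigr => i _; rewrite mulrDl mulrA.
Qed.

HB.instance Definition _ :=
  isIdealr.Build {mpoly int[n]} cyclic_relations cyclic_relations_idealr.

Definition cyclic_ideal : idealr {mpoly int[n]} := cyclic_relations.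

Definition cyclic_ring : comNzRingType := {ideal_quot cyclic_ideal}.

Definition multi_index : finType := {dffun forall i : 'I_n, 'I_(r i)}.

Definition tensor : zmodType := {ffun multi_index -> int}.

Definition tensor_poly (A : tensor) : {mpoly int[n]} :=
  \sum_(a : multi_index) A a *: 'X_[[multinom (a i : nat) | i < n]].

Definition tensor_class (A : tensor) : cyclic_ring :=
  \pi_({ideal_quot cyclic_ideal}) (tensor_poly A).

(* The coefficient at [a] of the image of [p] in the group ring: monomials are
   identified when their exponents agree modulo the [r i]. *)
Definition fold_coef (a : multi_index) (p : {mpoly int[n]}) : int :=
  \sum_(m <- msupp p) if [forall i, (m i %% r i == a i)%N] then p@_m else 0.

Lemma fold_coefw a k p : (msize p <= k)%N ->
  fold_coef a p =
  \sum_(m : 'X_{1..n < k}) if [forall i, (m i %% r i == a i)%N] then p@_m else 0.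
Proof.
move=> le_pk; set J : subFinType _ := 'X_{1..n < k}.
rewrite /fold_coef (big_mksub J) ?msupp_uniq //=; first last.
  by move=> x /msize_mdeg_lt /leq_trans; apply.
by rewrite big_rmcond //= => m /memN_msupp_eq0 ->; rewrite if_same.
Qed.

Lemma fold_coef_is_additive a : zmod_morphism (fold_coef a).
Proof.
move=> p q; set k := maxn (msize p) (maxn (msize q) (msize (p - q))).
rewrite !(@fold_coefw _ k) ?leq_max ?leqnn ?orbT // -sumrB.
by apply: eq_bigr => m _; rewrite mcoeffB; case: ifP; rewrite ?subr0.
Qed.
HB.instance Definition _ a := GRing.isZmodMorphism.Build _ _ (fold_coef a)
  (fold_coef_is_additive a).

Lemma fold_coefZX a (c : int) m : fold_coef a (c *: 'X_[m]) =
  if [forall i, (m i %% r i == a i)%N] then c else 0.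
Proof.
have [->|c0] := eqVneq c 0; first by rewrite scale0r raddf0 if_same.
by rewrite /fold_coef msuppMCX // big_seq1 mcoeffZ mcoeffX eqxx mulr1.
Qed.

Lemma fold_coef_rel a p : cyclic_relations p -> fold_coef a p = 0.
Proof.
move=> /asboolP[q ->]; rewrite raddf_sum big1 // => i _.
elim/mpolyind: (q i) => [|c m p' _ _ IH]; first by rewrite mul0r raddf0.
rewrite mulrDl raddfD /= {}IH addr0 /cyclic_gen mulrBr mulr1 raddfB /=.
rewrite mpolyXn -scalerAl -mpolyXD !fold_coefZX; apply/eqP; rewrite subr_eq0; apply/eqP.
congr (if _ then _ else _); apply: eq_forallb => j.
rewrite mnmDE mulmnE mnm1E; have [<-|_] := eqVneq i j.
  by rewrite mul1n modnDr.
by rewrite mul0n addn0.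
Qed.

Lemma fold_coef_tensor a A : fold_coef a (tensor_poly A) = A a.
Proof.
rewrite /tensor_poly raddf_sum (bigD1 a) //= big1 ?addr0 => [|b ba]; rewrite fold_coefZX.
  by case: ifP => // /forallP[] i; rewrite mnmE modn_small.
case: ifP => // /forallP h; case/eqP: ba; apply/ffunP => i; apply: val_inj.
by have := h i; rewrite mnmE modn_small // => /eqP.
Qed.

Local Notation Q := {ideal_quot cyclic_ideal}.

Lemma pi_rel p q : (\pi_Q p = \pi_Q q) <-> cyclic_relations (p - q).
Proof.
have -> : cyclic_relations (p - q) = (p - q \in (cyclic_ideal : pred _)) by [].
by rewrite Quotient.idealrBE; split=> /eqP.
Qed.

Lemma pi_X i : (\pi_Q 'X_i : cyclic_ring) ^+ r i = 1.
Proof.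
rewrite -(rmorphXn (\pi_Q : {rmorphism _ -> cyclic_ring})).
rewrite -(rmorph1 (\pi_Q : {rmorphism _ -> cyclic_ring})) /=.
apply/pi_rel/asboolP; exists (fun j => (j == i)%:R).
rewrite (bigD1 i) //= eqxx mul1r big1 ?addr0 // => j /negPf ->.
by rewrite mul0r.
Qed.

Lemma pi_monomial m : \pi_Q 'X_[m] = \pi_Q 'X_[[multinom (m i %% r i)%N | i < n]].
Proof.
rewrite [in LHS]mpolyXE_id [in RHS]mpolyXE_id.
rewrite !(rmorph_prod (\pi_Q : {rmorphism _ -> cyclic_ring})) /=.
apply: eq_bigr => i _; rewrite mnmE.
rewrite !(rmorphXn (\pi_Q : {rmorphism _ -> cyclic_ring})) /=.
by rewrite {1}(divn_eq (m i) (r i)) exprD mulnC exprM pi_X expr1n mul1r.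
Qed.

Lemma tensor_poly_is_additive : zmod_morphism tensor_poly.
Proof.
move=> A B; rewrite /tensor_poly -sumrB; apply: eq_bigr => a _.
by rewrite !ffunE scalerBl.
Qed.

Lemma tensor_class_surj : (forall i, 0 < r i)%N ->
  forall p, exists A, tensor_class A = \pi_Q p.
Proof.
move=> r0.
elim/mpolyind => [|c m p _ _ [A hA]].
  by exists 0; rewrite /tensor_class /tensor_poly big1 // => a _; rewrite ffunE scale0r.
pose a : multi_index := [ffun i => Ordinal (ltn_pmod (m i) (r0 i)) : 'I_(r i)].
exists (A - [ffun b => if b == a then - c else 0]).
rewrite /tensor_class tensor_poly_is_additive.
rewrite (rmorphB (\pi_Q : {rmorphism _ -> cyclic_ring})) /= [\pi_Q _]hA.
rewrite (rmorphD (\pi_Q : {rmorphism _ -> cyclic_ring})) /= addrC; congr (_ + _).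
rewrite /tensor_poly (bigD1 a) //= big1 ?addr0; last first.
  by move=> b /negPf ba; rewrite ffunE ba scale0r.
rewrite ffunE eqxx -(rmorphN (\pi_Q : {rmorphism _ -> cyclic_ring})) /= scaleNr opprK.
rewrite -!mul_mpolyC !(rmorphM (\pi_Q : {rmorphism _ -> cyclic_ring})) /=.
congr (_ * _); rewrite [RHS]pi_monomial; congr (\pi_Q 'X_[_]).
by apply/mnmP => i; rewrite !mnmE ffunE.
Qed.

Lemma tensor_class_inj : injective tensor_class.
Proof.
move=> A B /pi_rel h; apply/ffunP => a.
rewrite -!fold_coef_tensor; apply/eqP; rewrite -subr_eq0 -raddfB /=.
by apply/eqP/fold_coef_rel.
Qed.

Lemma tensor_class_bij : (forall i, 0 < r i)%N -> bijective tensor_class.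
Proof.
move=> r0.
have s x : exists A, tensor_class A == x :> cyclic_ring.
  by have [A hA] := tensor_class_surj r0 (repr x); exists A; rewrite hA reprK.
exists (fun x => xchoose (s x)) => x; last exact/eqP/(xchooseP (s x)).
by apply: tensor_class_inj; apply/eqP/(xchooseP (s _)).
Qed.

(* The image in Z^N of a subset of the quotient ring: [tensor_class] is the
   inverse of the coefficient identification (it is bijective when all [r i]
   are positive, see [tensor_class_bij]). *)
Definition coef_tensors (I : set cyclic_ring) : set tensor :=
  tensor_class @^-1` I.

(* [ord_pred j] is [j - 1] modulo [r k]: the slice of [cyclic_shift i A] at
   [j] is the slice of [A] at [j - 1], i.e. (A_i(r_i - 1), A_i(0), ...). *)
Definition shift_index (i : 'I_n) (a : multi_index) : multi_index :=
  [ffun k : 'I_n => (if k == i then ord_pred (a k) else a k) : 'I_(r k)].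

Definition cyclic_shift (i : 'I_n) (A : tensor) : tensor :=
  [ffun a => A (shift_index i a)].

Definition is_multivariate_cyclic_lattice (L : set tensor) : Prop :=
  is_lattice L /\ (forall v, L v -> forall i, L (cyclic_shift i v)).

End CyclicQuotient.

(* Main.v *)
Require Import Defs.
From mathcomp Require Import all_boot all_order all_algebra.
From mathcomp Require Import boolp classical_sets.
From HB Require Import structures.
From mathcomp Require Import ring_quotient mpoly.

(** Multiplication by the class of [x_i] acts on coefficient tensors as the
    shift [sigma_i], because [x_i ^ r_i = 1] in the quotient; an ideal is stable
    under this multiplication. *)

Set Implicit Arguments.
Unset Strict Implicit.
Unset Printing Implicit Defensive.

Import GRing.Theory.
Local Open Scope ring_scope.
Local Open Scope quotient_scope.

(** The coefficient identification is additive, so the tensors of an ideal form a subgroup, with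
    negation being multiplication by [-1]. By [tensor_class_shift], a cyclic shift is multiplication
    by the class of ['X_i], which an ideal absorbs. *)

Section TensorClass.
Variables (n : nat) (r : 'I_n -> nat).

Local Notation Q := {ideal_quot cyclic_ideal r}.
Local Notation piQ := (\pi_Q : {rmorphism {mpoly int[n]} -> cyclic_ring r}).

Lemma tensor_class_is_additive : zmod_morphism (@tensor_class n r).
Proof.
by move=> A B; rewrite /tensor_class tensor_poly_is_additive (rmorphB piQ).
Qed.

HB.instance Definition _ :=
  GRing.isZmodMorphism.Build _ _ (@tensor_class n r) tensor_class_is_additive.

Lemma shift_index_inj i : injective (@shift_index n r i).
Proof.
move=> a b /ffunP ab; apply/ffunP => k; have := ab k; rewrite !ffunE.
by case: ifP => // _; apply: ord_pred_inj.
Qed.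

(** The wrap-around case: if [a i] is [0], the product has exponent [r i] in ['X_i], which reduces
    to [0] in the quotient. *)
Lemma pi_monomial_shift i (a : multi_index r) :
  \pi_Q ('X_i * 'X_[[multinom (shift_index i a k : nat) | k < n]])
    = \pi_Q 'X_[[multinom (a k : nat) | k < n]].
Proof.
rewrite -mpolyXD [LHS]pi_monomial; congr (\pi_Q 'X_[_]); apply/mnmP => k.
rewrite !mnmE ffunE [i == k]eq_sym; case: eqP => [_|_]; last by rewrite add0n modn_small.
(* The value of [ordS j] is by definition [j.+1 %% r k], so [ord_predK] gives the goal. *)
by rewrite add1n -[RHS](congr1 val (ord_predK (a k))).
Qed.

Lemma tensor_class_shift i (A : tensor r) :
  tensor_class (cyclic_shift i A) = piQ 'X_i * tensor_class A.
Proof.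
rewrite /tensor_class -[RHS](rmorphM piQ) /tensor_poly /=.
(* After reindexing, both sums carry the coefficient [A (shift_index i a)], so only the monomials
   remain to be compared. *)
rewrite [in RHS](reindex_inj (@shift_index_inj i)) mulr_sumr.
rewrite [LHS](raddf_sum piQ) [RHS](raddf_sum piQ).
apply: eq_bigr => a _; rewrite ffunE -scalerAr -!mul_mpolyC /=.
by rewrite [LHS](rmorphM piQ) [RHS](rmorphM piQ) /= pi_monomial_shift.
Qed.

End TensorClass.

Theorem proposition3p6 (n : nat) (r : 'I_n -> nat)
  (hn : (0 < n)%N) (hr : forall i : 'I_n, (0 < r i)%N)
  (I : set (cyclic_ring r)) (hI : is_ideal I) :
  is_multivariate_cyclic_lattice (coef_tensors I).
Proof.
case: hI => I0 ID IM; rewrite /coef_tensors; split; first split=> /=.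
- by rewrite raddf0.
- by move=> u v Iu Iv; rewrite raddfD; apply: ID.
- by move=> u Iu; rewrite raddfN -mulN1r; apply: IM.
- by move=> v Iv i /=; rewrite tensor_class_shift; apply: IM.
Qed.
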